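(* Let $X$ be a vector field of class $C^{2}$ on an open subset of $\mathbb{R}^{2}$ and let $p$ be a point with $X(p)=0$ such that $J=DX(p)$ is nilpotent of rank one. Let $q_{0}$ span $\ker J$, and let $a,b$ be the Bogdanov--Takens coefficients of $X$ at $p$ computed from a Kuznetsov basis adapted to $q_{0}$. Then $$a=-\tfrac12\,\langle \nabla(\det DX)(p),\,q_{0}\rangle,\qquad b=\langle \nabla(\operatorname{tr} DX)(p),\,q_{0}\rangle .$$
   Context: $\langle\cdot,\cdot\rangle$ is the standard inner product on $\mathbb{R}^2$. $\det DX$ and $\operatorname{tr}DX$ are regarded as the functions $z\mapsto\det DX(z)$, $z\mapsto \operatorname{tr}DX(z)$. Put $B(u,v):=D^{2}X(p)[u,v]$ (the symmetric bilinear second-derivative form). A Kuznetsov basis adapted to $q_0$ is a quadruple $(q_0,q_1,p_0,p_1)$ of vectors of $\mathbb{R}^2$ with $Jq_0=0$, $Jq_1=q_0$, $J^{\top}p_1=0$, $J^{\top}p_0=p_1$, and $\langle q_0,p_0\rangle=\langle q_1,p_1\rangle=1$, $\langle q_0,p_1\rangle=\langle q_1,p_0\rangle=0$. The associated Bogdanov--Takens coefficients are $$a=\tfrac12\langle p_1,B(q_0,q_0)\rangle,\qquad b=\langle p_0,B(q_0,q_0)\rangle+\langle p_1,B(q_0,q_1)\rangle .$$ *)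

(* Defs.v *)
From mathcomp Require Export all_boot all_order all_algebra.
From mathcomp Require Export all_classical all_reals all_analysis.
Export Order.TTheory GRing.Theory Num.Theory.
Export numFieldNormedType.Exports.

Set Implicit Arguments.
Unset Strict Implicit.
Unset Printing Implicit Defensive.

Local Open Scope classical_set_scope.
Local Open Scope ring_scope.

(* Points and vectors of R^n are row vectors, and DX(z) is the library's
   [jacobian X z], for which [v *m jacobian X z] is the differential of X at z
   applied to v.  A matrix A thus acts by v |-> v *m A, and its transpose
   A^T, the adjoint for [dot], by v |-> v *m A^T.  With the usual column
   convention this A is the transposed matrix; rank, trace, determinant and
   nilpotency are unaffected. *)

Definition dot {R : realType} {n : nat} (u v : 'rV[R]_n) : R :=
  \sum_(i < n) u 0 i * v 0 i.

(* For open U.  In finite dimension, continuity of z |-> Df(z) in operator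
   norm is continuity of z |-> Df(z) v for each v. *)
Definition classC1 {R : realType} {n : nat} {W : normedModType R}
    (U : set 'rV[R]_n) (f : 'rV[R]_n -> W) : Prop :=
  (forall z, U z -> differentiable f z) /\
  (forall v z, U z -> {for z, continuous (fun y => 'd f y v)}).

(* [X] is total, but only its values on the open set U matter: differentials
   at points of U depend only on germs. *)
Definition classC2 {R : realType} {n m : nat}
    (U : set 'rV[R]_n) (X : 'rV[R]_n -> 'rV[R]_m) : Prop :=
  classC1 U X /\ classC1 U (jacobian X).

(* D^2 X(p)[u, v] = (D(DX)(p) u) v *)
Definition second_diff {R : realType} {n m : nat}
    (X : 'rV[R]_n -> 'rV[R]_m) (p u v : 'rV[R]_n) : 'rV[R]_m :=
  v *m ('d (jacobian X) p u).

Definition gradient {R : realType} {n : nat} (f : 'rV[R]_n -> R)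
    (p : 'rV[R]_n) : 'rV[R]_n :=
  \row_(j < n) 'D_(delta_mx 0 j) f p.

Record kuznetsov_basis {R : realType} (J : 'M[R]_2)
    (q0 q1 p0 p1 : 'rV[R]_2) : Prop := KuznetsovBasis {
  kuznetsov_Jq0 : q0 *m J = 0 ;
  kuznetsov_Jq1 : q1 *m J = q0 ;
  kuznetsov_JTp1 : p1 *m J^T = 0 ;
  kuznetsov_JTp0 : p0 *m J^T = p1 ;
  kuznetsov_q0p0 : dot q0 p0 = 1 ;
  kuznetsov_q1p1 : dot q1 p1 = 1 ;
  kuznetsov_q0p1 : dot q0 p1 = 0 ;
  kuznetsov_q1p0 : dot q1 p0 = 0
}.

Definition bt_a {R : realType} (X : 'rV[R]_2 -> 'rV[R]_2)
    (p q0 p1 : 'rV[R]_2) : R :=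
  2^-1 * dot p1 (second_diff X p q0 q0).

Definition bt_b {R : realType} (X : 'rV[R]_2 -> 'rV[R]_2)
    (p q0 q1 p0 p1 : 'rV[R]_2) : R :=
  dot p0 (second_diff X p q0 q0) + dot p1 (second_diff X p q0 q1).

(* Main.v *)
(* Let T = D(DX)(p) q0. As p0^T q0 + p1^T q1 = 1, the trace of T is
   <p0, q0 T> + <p1, q1 T> = b, and J = (p0^T q0 + p1^T q1) J = p1^T q0.
   Since tr J = <q0, p1> = 0, the adjugate of J is -J, so Jacobi's formula gives
   the derivative of det DX along q0 as - tr (J T) = - <p1, q0 T> = - 2 a. *)

Require Import Defs.
From mathcomp Require Import ring.

Local Open Scope classical_set_scope.
Local Open Scope ring_scope.

(** Cyclicity of the trace. In this form pairings can be added and regrouped as traces of matrix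
    products. *)
Lemma dot_mxtrace {R : realType} {n} (u v : 'rV[R]_n) :
  dot u v = \tr (v^T *m u).
Proof.
by rewrite mxtrace_mulC /mxtrace big_ord1 mxE; apply: eq_bigr => i _; rewrite mxE.
Qed.

Lemma dotC {R : realType} {n} (u v : 'rV[R]_n) : dot u v = dot v u.
Proof. by apply: eq_bigr => i _; rewrite mulrC. Qed.

(** Expand [v] in the standard basis and use linearity of the differential. *)
Lemma dot_gradient {R : realType} {n} (f : 'rV[R]_n -> R) (p v : 'rV[R]_n) :
  differentiable f p -> dot (gradient f p) v = 'd f p v.
Proof.
move=> df; rewrite {2}[v]row_sum_delta linear_sum; apply: eq_bigr => j _.
by rewrite linearZ /= mxE deriveE// mulrC.
Qed.

Lemma mxtrace2 {R : pzSemiRingType} (A : 'M[R]_2) : \tr A = A 0 0 + A 1 1.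
Proof. by rewrite /mxtrace big_ord_recl big_ord1; congr (_ + A _ _); apply/val_inj. Qed.

Lemma det2 {R : comPzRingType} (A : 'M[R]_2) :
  \det A = A 0 0 * A 1 1 - A 0 1 * A 1 0.
Proof.
rewrite (expand_det_row _ 0) big_ord_recl big_ord1 /cofactor !det_mx11 !mxE /=.
rewrite expr0 mul1r expr1 mulN1r mulrN.
by congr (A _ _ * A _ _ - A _ _ * A _ _); apply/val_inj.
Qed.

Lemma differentiable_entry {R : realType} {n} (F : 'rV[R]_n -> 'M[R]_2)
    (p : 'rV[R]_n) i j :
  differentiable F p -> differentiable (fun z => F z i j) p.
Proof.
by move=> dF; exact: (differentiable_comp dF (differentiable_coord (F p) i j)).
Qed.

Lemma derive_entry {R : realType} {n} (F : 'rV[R]_n -> 'M[R]_2)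
    (p v : 'rV[R]_n) i j :
  differentiable F p -> 'D_v (fun z => F z i j) p = ('d F p v) i j.
Proof.
by move=> dF; rewrite -deriveE// derive_mx ?mxE//; apply: diff_derivable.
Qed.

Lemma dot_gradient_mxtrace {R : realType} {n} (F : 'rV[R]_n -> 'M[R]_2)
    (p v : 'rV[R]_n) :
  differentiable F p ->
  dot (gradient (fun z => \tr (F z)) p) v = \tr ('d F p v).
Proof.
move=> dF; have -> : (fun z => \tr (F z)) = (fun z => F z 0 0) \+ (fun z => F z 1 1).
  by apply/funext => z; rewrite mxtrace2.
have df := differentiableD
  (differentiable_entry _ _ 0 0 dF) (differentiable_entry _ _ 1 1 dF).
rewrite dot_gradient// -deriveE// deriveD; first last.
- exact/diff_derivable/differentiable_entry.
- exact/diff_derivable/differentiable_entry.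
by rewrite !(derive_entry F)// mxtrace2.
Qed.

(* Jacobi's formula, with the adjugate of a 2x2 matrix A written tr A - A. *)
Lemma dot_gradient_det {R : realType} {n} (F : 'rV[R]_n -> 'M[R]_2)
    (p v : 'rV[R]_n) :
  differentiable F p -> dot (gradient (fun z => \det (F z)) p) v
  = \tr (F p) * \tr ('d F p v) - \tr (F p *m 'd F p v).
Proof.
move=> dF; pose f i j z := F z i j.
(* As a pointwise expression in the entry functions, the determinant is open to the product rule. *)
have -> : (fun z => \det (F z)) = f 0 0 * f 1 1 - f 0 1 * f 1 0.
  by apply/funext => z; rewrite det2.
have df i j : differentiable (f i j) p by exact: differentiable_entry.
have dM i j k l := differentiableM (df i j) (df k l).
rewrite dot_gradient; last exact: differentiableB.
rewrite -deriveE; last exact: differentiableB.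
have vM i j k l : derivable (f i j * f k l) p v by exact/diff_derivable.
rewrite deriveB// !deriveM; try exact/diff_derivable.
rewrite /f !(derive_entry F)// /GRing.scale /= !mxtrace2 !mxE !big_ord_recl !big_ord0.
have -> : lift ord0 ord0 = 1 :> 'I_2 by apply/val_inj.
ring.
Qed.

(** Biorthogonality says that the matrix with rows [q0], [q1] times the one with columns [p0^T],
    [p1^T] is the identity. For square matrices the product in the other order is then the identity
    too. *)
Lemma kuznetsov_resolution {R : realType} (J : 'M[R]_2) (q0 q1 p0 p1 : 'rV[R]_2) :
  kuznetsov_basis J q0 q1 p0 p1 -> p0^T *m q0 + p1^T *m q1 = 1%:M.
Proof.
case=> _ _ _ _ q0p0 q1p1 q0p1 q1p0.
have dotE (u v : 'rV[R]_2) : u *m v^T = (dot u v)%:M.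
  apply/matrixP => i j; rewrite !ord1 !mxE eqxx mulr1n.
  by apply: eq_bigr => k _; rewrite mxE.
have : col_mx q0 q1 *m row_mx p0^T p1^T = 1%:M.
  rewrite mul_col_row !dotE q0p0 q1p1 q0p1 q1p0.
  rewrite !(raddf0 (scalar_mx (n := 1))).
  by rewrite [RHS](scalar_mx_block 1 1).
by move/(@mulmx1C _ (1 + 1)); rewrite mul_row_col.
Qed.

Theorem theoremA (R : realType) (U : set 'rV[R]_2)
    (X : 'rV[R]_2 -> 'rV[R]_2) (p : 'rV[R]_2)
    (U_open : open U) (X_C2 : classC2 U X)
    (p_in_U : U p) (X_p : X p = 0)
    (J_nilpotent : exists k : nat, jacobian X p ^+ k = 0)
    (J_rank1 : \rank (jacobian X p) = 1%N)
    (q0 q1 p0 p1 : 'rV[R]_2)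
    (q0_spans_ker : (q0 :=: kermx (jacobian X p))%MS)
    (basis : kuznetsov_basis (jacobian X p) q0 q1 p0 p1) :
  bt_a X p q0 p1
    = - 2^-1 * dot (gradient (fun z => \det (jacobian X z)) p) q0 /\
  bt_b X p q0 q1 p0 p1
    = dot (gradient (fun z => \tr (jacobian X z)) p) q0.
Proof.
have dF : differentiable (jacobian X) p by case: X_C2 => _ [+ _]; apply.
have res := kuznetsov_resolution _ _ _ _ _ basis.
case: basis => Jq0 Jq1 _ _ _ _ q0p1 _.
have JE : jacobian X p = p1^T *m q0.
  by rewrite -[LHS]mul1mx -res mulmxDl -!mulmxA Jq0 Jq1 mulmx0 add0r.
split.
  (* The trace of [p1^T *m q0] is [dot q0 p1 = 0], so only the trace of the product survives in
     Jacobi's formula. *)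
  rewrite /bt_a /second_diff dot_gradient_det// JE -dot_mxtrace q0p1 mul0r sub0r.
  by rewrite mulrNN -mulmxA -dot_mxtrace dotC.
(* Both terms of b differentiate the Jacobian along [q0], so they share the factor T and their
   traces combine. *)
rewrite /bt_b /second_diff dot_gradient_mxtrace// dotC [dot p1 _]dotC.
by rewrite !dot_mxtrace -mxtraceD !mulmxA -mulmxDl res mul1mx.
Qed.
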